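(* Let $n\in\mathbb{N}=\{1,2,3,\dots\}$, let $\nu\in\mathbb{R}$ with $n-1<\nu<n$, and let $x\in(-1,1)$. Then the C-Legendre function $P_\nu$ satisfies $$P_\nu(x)=(-1)^\nu\;{}_2F_1\left(-\nu,\nu+1;1;\frac{x+1}{2}\right).$$
   Context: For $n\in\mathbb{N}$, $n-1<\nu<n$ and $x>a$, the Caputo fractional derivative of order $\nu$ with lower terminal $a$ is $${}_aD^\nu_*f(x)=\frac{1}{\Gamma(n-\nu)}\int_a^x\frac{f^{(n)}(\tau)}{(x-\tau)^{\nu+1-n}}\,d\tau .$$ For $n-1<\nu<n$ and $x\in(-1,1)$ the C-Legendre function is defined by $$P_\nu(x)=\frac{(-1)^\nu}{2^\nu\,\Gamma(\nu+1)}\;{}_{-1}D^\nu_*\left[(1-x^2)^{\nu}\right],$$ where $(-1)^s:=e^{i\pi s}$ for real $s$. ${}_2F_1(a,b;c;z)=\sum_{k\ge0}\frac{(a)_k(b)_k}{(c)_k}\frac{z^k}{k!}$ for $|z|<1$, with $(a)_0=1$ and $(a)_k=a(a+1)\cdots(a+k-1)$. *)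

(* Defs.v *)
From HB Require Import structures.
From mathcomp Require Export all_boot all_order all_algebra.
From mathcomp Require Export all_classical all_reals all_analysis.
From mathcomp Require Export complex.
Export Order.TTheory GRing.Theory Num.Theory.
Export numFieldNormedType.Exports.

Set Implicit Arguments.
Unset Strict Implicit.
Unset Printing Implicit Defensive.

Local Open Scope classical_set_scope.
Local Open Scope ring_scope.
Local Open Scope complex_scope.

(* Euler's integral, meaningful for [0 < s]; only such arguments occur below. *)
Definition Gamma (R : realType) (s : R) : R :=
  \int[lebesgue_measure]_(t in `]0, +oo[) (t `^ (s - 1) * expR (- t)).

(* [n] is explicit and meant to satisfy [n - 1 < nu < n]. The Lebesgue integral
   covers the singularities of the integrand at both endpoints. *)
Definition caputo (R : realType) (n : nat) (nu a : R) (f : R -> R) (x : R) : R :=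
  (Gamma (n%:R - nu))^-1 *
  \int[lebesgue_measure]_(tau in `]a, x[)
     (derive1n n f tau / (x - tau) `^ (nu + 1 - n%:R)).

Definition cexp (R : realType) (z : R[i]) : R[i] :=
  (expR (complex.Re z))%:C * (cos (complex.Im z) +i* sin (complex.Im z)).

(* (-1)^s := e^(i pi s) *)
Definition neg1pow (R : realType) (s : R) : R[i] := cexp (0 +i* (pi * s)).

(* [powR] has junk values at negative bases, but [caputo] only looks at
   derivatives inside ]-1, x[, where 1 - t^2 > 0 when x < 1. *)
Definition CLegendre (R : realType) (n : nat) (nu x : R) : R[i] :=
  neg1pow nu / (2 `^ nu * Gamma (nu + 1))%:C *
  (caputo n nu (-1) (fun t => (1 - t ^+ 2) `^ nu) x)%:C.

Definition pochhammer (R : realType) (a : R) (k : nat) : R :=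
  \prod_(i < k) (a + i%:R).

Definition hyp2F1 (R : realType) (a b c z : R) : R :=
  limn (series (fun k : nat =>
    pochhammer a k * pochhammer b k / pochhammer c k * (z ^+ k / k`!%:R))).

(* Main.v *)
Require Import Defs.
From mathcomp Require Import measurable_realfun.
From mathcomp Require Import ring lra.

(** Near its lower terminal -1 the function (1 - t^2)^nu is a power of the
    distance to -1 times an analytic function: with u = (t + 1) / 2 one has
    1 - t^2 = 4 u (1 - u), so that
      (1 - t^2)^nu = 4^nu u^nu sum_k c_k u^k,  c_k = (-nu)_k / k!,
    by the binomial series ([binomial_series]). Everything that the Caputo
    derivative does to this function can be done term by term.

    Differentiating u^mu sum_k c_k u^k multiplies c_k by mu + k and lowers the
    exponent mu by one ([is_derive_powR_pseries]); n steps produce u^(nu - n)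
    and the falling products of [derived_coef] ([derived_powR_expansion]).

    The remaining integral against (x - t)^(n - nu - 1) is, for each term, a
    Beta integral, and sum and integral can be exchanged by dominated
    convergence, because u stays below (x + 1) / 2 < 1 and the series converges
    absolutely there ([cvg_fractional_integral_pseries]). The Beta integral is
    evaluated by B(p, q) Gamma(p + q) = Gamma(p) Gamma(q) ([betaE_gammaE]);
    here p = nu - n + 1 + k and q = n - nu, so p + q = k + 1 and the
    denominator is k!. The falling product in the coefficient turns
    Gamma(nu - n + 1 + k) into Gamma(nu + 1 + k) = (nu + 1)_k Gamma(nu + 1),
    which leaves 2^nu Gamma(nu + 1) times the hypergeometric term
    (-nu)_k (nu + 1)_k / (k!)^2 ((x + 1) / 2)^k.

    The Gamma facts all come from the Beta identity itself, read in the
    extended reals so that no finiteness is needed beforehand: since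
    B(s, 1) = 1 / s, its case q = 1 is the functional equation of Gamma. *)

Set Implicit Arguments.
Unset Strict Implicit.
Unset Printing Implicit Defensive.

Local Open Scope classical_set_scope.
Local Open Scope ring_scope.

(** * Affine changes of variable *)

Lemma measurable_affine (R : realType) (a b : R) :
  measurable_fun setT (fun x : R => a * x + b).
Proof. by apply: measurable_funD => //; exact: measurable_funM. Qed.

(** Lebesgue measure is determined by its values on intervals, and a times the
    image of Lebesgue measure under x |-> a x + b gives each interval its
    length. *)
Lemma ge0_integral_affine (R : realType) (a b : R) (f : R -> \bar R) :
  0 < a -> measurable_fun setT f -> (forall x, 0 <= f x)%E ->
  (a%:E * \int[@lebesgue_measure R]_x f (a * x + b)%R =
   \int[@lebesgue_measure R]_x f x)%E.
Proof.
move=> a0 mf f0.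
pose phi : measurableTypeR R -> measurableTypeR R := fun x => a * x + b.
have mphi : measurable_fun setT phi by exact: measurable_affine.
pose k : {nonneg R} := NngNum (ltW a0).
(* The measure structure of a pushforward depends on a measurability proof. *)
pose nu0 := mscale k (pushforward lebesgue_measure phi)
  : {measure set (measurableTypeR R) -> \bar R}.
pose nu := nu0 mphi.
have nuE A : measurable A -> lebesgue_measure A = nu A.
  apply: lebesgue_measure_unique => _ [[c d] _ <-] /=.
  rewrite /nu /mscale /= /pushforward /=.
  rewrite (_ : phi @^-1` _ = `](c - b) / a, (d - b) / a]%classic); last first.
    apply/seteqP; split=> x /=; rewrite !in_itv/= /phi ltr_pdivrMr// ler_pdivlMr//;
    by rewrite ltrBlDr lerBrDr mulrC.
  rewrite !lebesgue_measure_itv/= !lte_fin ltr_pM2r ?invr_gt0// ltrD2r.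
  case: ifP => _; last by rewrite mule0.
  rewrite -!EFinB -EFinM; congr EFin; field; exact: lt0r_neq0.
rewrite [RHS](eq_measure_integral nu); last by move=> A mA _; exact: nuE.
rewrite ge0_integral_mscale//=; congr (_ * _)%E.
by rewrite ge0_integral_pushforward.
Qed.

(** * The Beta and Gamma integrals *)

(** The power t^(s - 1) cut off to the positive half-line. With the domains of
    integration absorbed into the integrands, all integrals are over the whole
    line and affine substitutions need no bookkeeping of intervals. *)
Definition truncpow (R : realType) (s t : R) : R :=
  if 0 < t then t `^ (s - 1) else 0.

(** Euler's integral over ]0, 1[, which is where both factors are nonzero. *)
Definition betaE (R : realType) (p q : R) : \bar R :=
  (\int[@lebesgue_measure R]_t (truncpow p t * truncpow q (1 - t))%:E)%E.

Definition gammaE (R : realType) (s : R) : \bar R :=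
  (\int[@lebesgue_measure R]_t (truncpow s t * expR (- t))%:E)%E.

Lemma truncpow_ge0 (R : realType) (s t : R) : 0 <= truncpow s t.
Proof. by rewrite /truncpow; case: ifP => // _; exact: powR_ge0. Qed.

Lemma truncpowM (R : realType) (s c t : R) : 0 < c ->
  truncpow s (c * t) = c `^ (s - 1) * truncpow s t.
Proof.
move=> c0; rewrite /truncpow pmulr_rgt0//; case: ifP => t0; last by rewrite mulr0.
by rewrite powRM// ltW.
Qed.

Lemma measurable_truncpow (R : realType) (s : R) :
  measurable_fun setT (@truncpow R s).
Proof.
apply: measurable_fun_ifT => //.
exact: measurable_fun_ltr.
Qed.

Lemma measurable_truncpow_comp d (T : measurableType d) (R : realType) (s : R)
  (g : T -> R) : measurable_fun setT g ->
  measurable_fun setT (fun t => truncpow s (g t)).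
Proof. by move=> mg; apply: measurableT_comp => //; exact: measurable_truncpow. Qed.

Lemma truncpow_addn (R : realType) (p t : R) (k : nat) :
  truncpow (p + k%:R) t = truncpow p t * t ^+ k.
Proof.
rewrite /truncpow; case: ltP => t0; last by rewrite mul0r.
rewrite -powR_mulrn ?ltW// -powRD ?(gt_eqF t0) ?implybT//.
by congr (_ `^ _); rewrite addrAC.
Qed.

(** Substituting t = (b - a) u + a turns the convolution of two truncated
    powers into a Beta integral; both sides vanish when b <= a. *)
Lemma integral_truncpow_mul (R : realType) (p q a b : R) :
  (\int[@lebesgue_measure R]_t (truncpow p (t - a) * truncpow q (b - t))%:E =
   (truncpow (p + q) (b - a))%:E * betaE p q)%E.
Proof.
have [ab|ba] := ltP a b; last first.
  rewrite [truncpow (p + q) _]/truncpow subr_gt0 ltNge ba/= mul0e.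
  apply: integral0_eq => t _; rewrite /truncpow !subr_gt0.
  case: ltP => [at_|]; last by rewrite mul0r.
  by case: ltP => [tb|]; [have := lt_le_trans (lt_trans at_ tb) ba; rewrite ltxx
    | rewrite mulr0].
have c0 : 0 < b - a by rewrite subr_gt0.
rewrite -(@ge0_integral_affine R (b - a) a _ c0); last 2 first.
- by apply/measurable_EFinP/measurable_funM; apply: measurable_truncpow_comp;
    exact: measurable_funB.
- by move=> t; rewrite lee_fin mulr_ge0// truncpow_ge0.
under eq_integral => t _.
  rewrite addrK.
  rewrite (_ : b - ((b - a) * t + a) = (b - a) * (1 - t)); last by ring.
  rewrite !truncpowM// mulrACA EFinM; over.
rewrite ge0_integralZl//=; last 3 first.
- apply/measurable_EFinP/measurable_funM; first exact: measurable_truncpow.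
  by apply: measurable_truncpow_comp; exact: measurable_funB.
- by move=> t _; rewrite lee_fin mulr_ge0// truncpow_ge0.
- by rewrite lee_fin mulr_ge0// powR_ge0.
rewrite muleA -EFinM; congr (_%:E * _)%E.
rewrite /truncpow c0 -[X in X * _]powRr1 ?ltW// -!powRD ?(gt_eqF c0) ?implybT//.
by congr (_ `^ _); ring.
Qed.

Lemma measurable_gamma_integrand (R : realType) (s : R) :
  measurable_fun setT (fun t => truncpow s t * expR (- t)).
Proof.
apply/measurable_funM; first exact: measurable_truncpow.
by apply: measurableT_comp.
Qed.

Lemma ge0_integralZr_EFin (R : realType) (f : R -> R) (k : R) :
  measurable_fun setT f -> (forall x, 0 <= f x) -> 0 <= k ->
  (\int[@lebesgue_measure R]_x (f x * k)%:E =
   \int[@lebesgue_measure R]_x (f x)%:E * k%:E)%E.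
Proof.
move=> mf f0 k0.
rewrite -ge0_integralZr//; first exact/measurable_EFinP.
by move=> x _; rewrite lee_fin.
Qed.

(** Integrate truncpow p t * truncpow q (w - t) * exp(-w) over the plane. For
    fixed w the integral in t is a truncated power of w times B(p, q); for
    fixed t the translation w |-> w + t splits exp(-w) and leaves Gamma(q).
    By Tonelli's theorem the identity holds in [0, +oo] without any condition
    on p and q. *)
Lemma betaE_gammaE (R : realType) (p q : R) :
  (betaE p q * gammaE (p + q) = gammaE p * gammaE q)%E.
Proof.
pose F (z : R * R) := (truncpow p z.1 * truncpow q (z.2 - z.1) * expR (- z.2))%:E.
have F0 z : (0 <= F z)%E by rewrite lee_fin !mulr_ge0// ?truncpow_ge0 ?expR_ge0.
have mF : measurable_fun setT F.
  apply/measurable_EFinP/measurable_funM; first apply: measurable_funM.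
  - exact: measurable_truncpow_comp.
  - by apply: measurable_truncpow_comp; exact: measurable_funB.
  - by apply: measurableT_comp => //; apply: measurableT_comp.
have inner_t w : (\int[@lebesgue_measure R]_t F (t, w) =
    (truncpow (p + q) w * expR (- w))%:E * betaE p q)%E.
  rewrite /F/= ge0_integralZr_EFin ?expR_ge0//.
  - have := integral_truncpow_mul p q 0 w.
    under eq_integral do rewrite subr0.
    by move=> ->; rewrite subr0 muleAC -EFinM.
  - by apply/measurable_funM; apply: measurable_truncpow_comp => //;
      exact: measurable_funB.
  - by move=> t; rewrite mulr_ge0// truncpow_ge0.
have inner_w t : (\int[@lebesgue_measure R]_w F (t, w) =
    (truncpow p t * expR (- t))%:E * gammaE q)%E.
  rewrite /F/= -(@ge0_integral_affine R 1 t) ?ltr01//; last 2 first.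
  - apply/measurable_EFinP/measurable_funM.
      apply: measurable_funM => //; apply: measurable_truncpow_comp.
      exact: measurable_funB.
    by apply: measurableT_comp.
  - by move=> w; rewrite lee_fin !mulr_ge0// ?truncpow_ge0 ?expR_ge0.
  rewrite mul1e muleC /gammaE -ge0_integralZr_EFin.
  - apply: eq_integral => w _; congr EFin.
    by rewrite mul1r addrK opprD expRD; ring.
  - exact: measurable_gamma_integrand.
  - by move=> w; rewrite mulr_ge0// ?truncpow_ge0 ?expR_ge0.
  - by rewrite mulr_ge0// ?truncpow_ge0 ?expR_ge0.
have := @fubini_tonelli _ _ _ _ R (@lebesgue_measure R) (@lebesgue_measure R) F mF F0.
under eq_integral do rewrite inner_w.
under [RHS]eq_integral do rewrite inner_t.
have g0 s : forall t, (0 <= (@truncpow R s t * expR (- t))%:E)%E.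
  by move=> t; rewrite lee_fin mulr_ge0// ?truncpow_ge0 ?expR_ge0.
have gZ s (k : \bar R) : (0 <= k)%E ->
    (\int[@lebesgue_measure R]_t ((truncpow s t * expR (- t))%:E * k) =
     gammaE s * k)%E.
  move=> k0; apply: ge0_integralZr => //.
  apply/measurable_EFinP; exact: measurable_gamma_integrand.
rewrite gZ; last by apply: integral_ge0 => t _; exact: g0.
rewrite gZ; last by apply: integral_ge0 => t _; rewrite lee_fin mulr_ge0// truncpow_ge0.
by move=> ->; rewrite muleC.
Qed.

Lemma continuous_powR (R : realType) (r x : R) : 0 < x ->
  {for x, continuous (fun t => t `^ r)}.
Proof.
move=> x0; apply: differentiable_continuous; apply/derivable1_diffP.
by apply: derivable_powR; rewrite in_itv/= x0.
Qed.

(** For p < 1 the integrand blows up at 0, so the fundamental theorem of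
    calculus is applied away from 0 and the limit a -> 0 is taken in
    [betaE_p1]. *)
Lemma integral_powR_away0 (R : realType) (p a : R) : 0 < p -> 0 < a < 1 ->
  (\int[@lebesgue_measure R]_(t in `[a, 1%R]) (t `^ (p - 1))%:E =
   (p^-1 - a `^ p / p)%:E)%E.
Proof.
move=> p0 /andP[a0 a1].
have cp r : {within `[a, 1], continuous (fun t : R => t `^ r)}.
  apply: continuous_in_subspaceT => x; rewrite inE/= in_itv/= => /andP[ax _].
  by apply: continuous_powR; exact: lt_le_trans ax.
have dF (x : R) : 0 < x -> is_derive x 1 (fun t : R => t `^ p / p) (x `^ (p - 1)).
  move=> x0; have := is_derive1_powR p x0 => D.
  apply: is_derive_eq; rewrite scaler0 add0r.
  by rewrite -[LHS]/(p^-1 * (p * _)) mulrA mulVf ?mul1r// gt_eqF.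
have cF (x : R) : 0 < x -> (fun t : R => t `^ p / p) t @[t --> x] --> x `^ p / p.
  move=> x0; apply: cvgMl; exact: continuous_powR.
rewrite (@continuous_FTC2 _ _ (fun t => t `^ p / p) _ _ a1 (cp _)).
- by rewrite powR1 div1r.
- split.
  + move=> x; rewrite in_itv/= => /andP[ax _].
    by have [] := dF _ (lt_trans a0 ax).
  + by apply: cvg_at_right_filter; exact: cF.
  + by apply: cvg_at_left_filter; exact: cF.
- move=> x; rewrite in_itv/= => /andP[ax _].
  by rewrite derive1E; have [_ ->] := dF _ (lt_trans a0 ax).
Qed.

Lemma betaE_p1 (R : realType) (p : R) : 0 < p -> betaE p 1 = (p^-1)%:E.
Proof.
move=> p0; pose F (n : nat) : set R := `[n.+2%:R^-1, 1]%classic.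
pose f (t : R) := (t `^ (p - 1))%:E.
have -> : betaE p 1 = (\int[@lebesgue_measure R]_(t in \bigcup_n F n) f t)%E.
  have -> : \bigcup_n F n = `]0, 1]%classic :> set R.
    apply/seteqP; split=> [x [n _]|x]; rewrite /F/= !in_itv/=.
      by case/andP => nx ->; rewrite andbT (lt_le_trans _ nx)// invr_gt0.
    move=> /andP[x0 x1]; have [N _ HN] := near_infty_natSinv_lt (PosNum x0).
    exists N => //=; rewrite in_itv/= x1 andbT ltW//.
    by have /= := HN N.+1; apply.
  rewrite -integral_itv_bndo_bndc; last first.
    by apply/measurable_EFinP/measurable_funTS.
  rewrite integral_mkcond; apply: eq_integral => t _.
  rewrite patchE/= mem_setE in_itv/= /truncpow subr_gt0 subrr powRr0.
  by case: ltP => t0/=; case: ltP => t1; rewrite ?mulr1 ?mulr0 ?mul0r.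
have a01 n : 0 < (n.+2%:R^-1 : R) < 1.
  by rewrite invr_gt0 ltr0n/= invf_lt1 ?ltr0n// ltr1n.
have cvg1 : (\int[@lebesgue_measure R]_(t in F n) f t)%E @[n --> \oo] --> (p^-1)%:E.
  rewrite (_ : (fun n => _) = (fun n => (p^-1 - n.+2%:R^-1 `^ p / p)%:E)); last first.
    by apply/funext => n; exact: integral_powR_away0.
  apply: cvg_EFin; first exact: nearW.
  rewrite -[X in _ --> X]subr0 -[X in _ --> _ - X](mul0r p^-1).
  apply: cvgB; first exact: cvg_cst.
  apply: cvgMl.
  have /cvg_at_rightP := @powR_cvg0 R p p0.
  move=> /(_ (fun n => n.+2%:R^-1)); apply; split.
    by move=> n; have /andP[] := a01 n.
  by have := @cvg_harmonic R; rewrite -cvg_shiftS.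
have cvg2 : (\int[@lebesgue_measure R]_(t in F n) f t)%E @[n --> \oo] -->
    (\int[@lebesgue_measure R]_(t in \bigcup_n F n) f t)%E.
  apply: ge0_nondecreasing_set_cvg_integral.
  - apply/nondecreasing_seqP => n; rewrite subsetEset => x; rewrite /F/= !in_itv/=.
    move=> /andP[nx ->]; rewrite andbT (le_trans _ nx)//.
    by rewrite lef_pV2 ?posrE ?ltr0n// ler_nat.
  - by move=> n; exact: measurable_itv.
  - by move=> n; apply/measurable_EFinP/measurable_funTS.
  - by move=> n x _; rewrite lee_fin powR_ge0.
by rewrite -(cvg_lim _ cvg2)//; exact: cvg_lim cvg1.
Qed.

Lemma Gamma_gammaE (R : realType) (s : R) : Gamma s = fine (gammaE s).
Proof.
rewrite /Gamma Rintegral_mkcond /Rintegral; congr fine.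
apply: eq_integral => t _; rewrite patchE mem_setE in_itv/= andbT /truncpow.
by case: ltP => //; rewrite mul0r.
Qed.

Lemma gammaE1 (R : realType) : gammaE (1 : R) = 1%E.
Proof.
rewrite -(integral_exponential_pdf (@ltr01 R)).
transitivity (\int[@lebesgue_measure R]_(t in `]0%R, +oo[) (expR (- t))%:E)%E.
  rewrite integral_mkcond; apply: eq_integral => t _.
  rewrite patchE mem_setE in_itv/= andbT /truncpow subrr powRr0.
  by case: ltP => //; rewrite ?mul1r ?mul0r.
rewrite integral_itv_obnd_cbnd; last first.
  by apply/measurable_EFinP/measurable_funTS; apply: measurableT_comp.
rewrite integral_mkcond; apply: eq_integral => t _.
rewrite /exponential_pdf !patchE; case: ifP => // _.
by rewrite mul1r mulN1r.
Qed.

Lemma gammaE_ge0 (R : realType) (s : R) : (0 <= gammaE s)%E.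
Proof.
by apply: integral_ge0 => t _; rewrite lee_fin mulr_ge0 ?truncpow_ge0 ?expR_ge0.
Qed.

(** The Beta identity with q = 1, since B(s, 1) = 1 / s and Gamma(1) = 1. *)
Lemma gammaES (R : realType) (s : R) : 0 < s ->
  gammaE (s + 1) = (s%:E * gammaE s)%E.
Proof.
move=> s0; have := betaE_gammaE s 1; rewrite betaE_p1// gammaE1 mule1 => <-.
by rewrite muleA -EFinM divff ?mul1e// gt_eqF.
Qed.

Lemma gammaE_nat (R : realType) (n : nat) : gammaE (n.+1%:R : R) = (n`!%:R)%:E.
Proof.
elim: n => [|n ih]; first by rewrite gammaE1 fact0.
by rewrite -[n.+2%:R]natr1 gammaES ?ltr0n// ih -EFinM -natrM factS.
Qed.

(** Pointwise, t^(s - 1) is at most t^(a - 1) when t <= 1 and at most t^(b - 1)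
    when t >= 1. Since Gamma is known at the integers, this crude comparison
    gives finiteness (with integers a and b) and positivity (with an integer s)
    elsewhere. *)
Lemma gammaE_interp (R : realType) (a s b : R) : a <= s -> s <= b ->
  (gammaE s <= gammaE a + gammaE b)%E.
Proof.
move=> as_ sb; rewrite /gammaE -ge0_integralD//; last 4 first.
- by move=> t _; rewrite lee_fin mulr_ge0 ?truncpow_ge0 ?expR_ge0.
- by apply/measurable_EFinP; exact: measurable_gamma_integrand.
- by move=> t _; rewrite lee_fin mulr_ge0 ?truncpow_ge0 ?expR_ge0.
- by apply/measurable_EFinP; exact: measurable_gamma_integrand.
apply: ge0_le_integral => //.
- by move=> t _; rewrite lee_fin mulr_ge0 ?truncpow_ge0 ?expR_ge0.
- by apply/measurable_EFinP; exact: measurable_gamma_integrand.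
- apply: emeasurable_funD; apply/measurable_EFinP; exact: measurable_gamma_integrand.
move=> t _; rewrite -EFinD lee_fin -mulrDl ler_wpM2r ?expR_ge0//.
rewrite /truncpow; case: ltP => t0; last by rewrite addr0.
have [t1|t1] := leP t 1.
- apply: (@le_trans _ _ (t `^ (a - 1))); last by rewrite lerDl powR_ge0.
  by apply: ger_powR; rewrite ?t0// lerB.
- apply: (@le_trans _ _ (t `^ (b - 1))); last by rewrite lerDr powR_ge0.
  by apply: ler_powR; rewrite ?(ltW t1)// lerB.
Qed.

(** Gamma(s + 1) is at most a sum of two factorials, and is s Gamma(s). *)
Lemma gammaE_EFin (R : realType) (s : R) : 0 < s -> gammaE s = (Gamma s)%:E.
Proof.
move=> s0; rewrite Gamma_gammaE fineK//.
rewrite ge0_fin_numE ?gammaE_ge0//.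
have [k ks sk] : exists2 k, k%:R <= s & s <= k.+1%:R.
  by exists (Num.trunc s); have /andP[? /ltW] := truncn_itv (ltW s0).
have : (s%:E * gammaE s < +oo)%E.
  rewrite -gammaES//; apply: (@le_lt_trans _ _ (gammaE k.+1%:R + gammaE k.+2%:R)%E).
    by apply: gammaE_interp; rewrite -natr1 lerD2r.
  by rewrite !gammaE_nat -EFinD ltry.
apply: contraTT; rewrite -leNgt leye_eq => /eqP->.
by rewrite gt0_muley ?lte_fin// ltxx.
Qed.

Lemma GammaS (R : realType) (s : R) : 0 < s -> Gamma (s + 1) = s * Gamma s.
Proof.
move=> s0; apply/EFin_inj.
by rewrite EFinM -!gammaE_EFin ?addr_gt0// gammaES.
Qed.

Lemma Gamma_nat (R : realType) (n : nat) : Gamma (n.+1%:R : R) = n`!%:R.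
Proof. by rewrite Gamma_gammaE gammaE_nat. Qed.

(** An integer k + 1 lies between s and s + 1, whence
    0 < k! <= Gamma(s) + Gamma(s + 1) = (1 + s) Gamma(s). *)
Lemma Gamma_gt0 (R : realType) (s : R) : 0 < s -> 0 < Gamma s.
Proof.
move=> s0.
have [k ks sk] : exists2 k, k%:R <= s & s <= k.+1%:R.
  by exists (Num.trunc s); have /andP[? /ltW] := truncn_itv (ltW s0).
have : (gammaE (k.+1%:R) <= gammaE s + gammaE (s + 1))%E.
  by apply: gammaE_interp => //; rewrite -natr1 lerD2r.
rewrite gammaE_nat !gammaE_EFin ?addr_gt0// GammaS// -EFinD lee_fin.
rewrite -[X in X + _]mul1r -mulrDl => h.
have : 0 < (1 + s) * Gamma s by rewrite (lt_le_trans _ h)// ltr0n fact_gt0.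
by rewrite pmulr_rgt0// addr_gt0.
Qed.

Lemma betaE_Gamma (R : realType) (p q : R) : 0 < p -> 0 < q ->
  betaE p q = (Gamma p * Gamma q / Gamma (p + q))%:E.
Proof.
move=> p0 q0; have pq0 : 0 < p + q by rewrite addr_gt0.
rewrite EFinM EFinM -!gammaE_EFin// -betaE_gammaE gammaE_EFin// -muleA -EFinM.
by rewrite divff ?mule1// gt_eqF// Gamma_gt0.
Qed.

Lemma Gamma_pochhammer (R : realType) (s : R) (k : nat) : 0 < s ->
  Gamma (s + k%:R) = pochhammer s k * Gamma s.
Proof.
move=> s0; elim: k => [|k ih]; first by rewrite addr0 /pochhammer big_ord0 mul1r.
rewrite -natr1 addrA GammaS ?ltr_wpDr// ih /pochhammer big_ord_recr/=.
by rewrite mulrA [X in _ = X * _]mulrC.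
Qed.

(** The functional equation n times; the hypothesis keeps all arguments
    positive. *)
Lemma Gamma_falling (R : realType) (mu : R) (n : nat) : n%:R < mu + 1 ->
  Gamma (mu + 1) = (\prod_(j < n) (mu - j%:R)) * Gamma (mu + 1 - n%:R).
Proof.
elim: n => [|n ih] h; first by rewrite big_ord0 mul1r subr0.
have h' : n%:R < mu by rewrite -(ltrD2r 1) natr1.
rewrite ih; last by rewrite (lt_trans h')// ltrDl.
rewrite big_ord_recr/= -mulrA -natr1; congr (_ * _).
have -> : mu + 1 - n%:R = (mu - n%:R) + 1 by ring.
by rewrite GammaS ?subr_gt0//; congr (_ * Gamma _); ring.
Qed.

Lemma pochhammer1 (R : realType) (k : nat) : pochhammer (1 : R) k = k`!%:R.
Proof.
elim: k => [|k ih]; first by rewrite /pochhammer big_ord0.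
by rewrite /pochhammer big_ord_recr/= -/(pochhammer 1 k) ih nat1r factS natrM mulrC.
Qed.

Lemma integral_truncpow_mul_Gamma (R : realType) (p q a b : R) :
  0 < p -> 0 < q -> a < b ->
  (\int[@lebesgue_measure R]_t (truncpow p (t - a) * truncpow q (b - t))%:E =
   ((b - a) `^ (p + q - 1) * (Gamma p * Gamma q / Gamma (p + q)))%:E)%E.
Proof.
move=> p0 q0 ab.
by rewrite integral_truncpow_mul betaE_Gamma// /truncpow subr_gt0 ab EFinM.
Qed.

(** * Power series on the unit disk *)

(** Equivalent to a radius of convergence of at least 1. This form, unlike
    summability, is visibly stable under multiplication of the coefficients by
    polynomials in k, hence under differentiation. *)
Definition disk_bounded (R : realType) (c : nat -> R) :=
  forall r, 0 < r < 1 -> exists M, forall k, `|c k| * r ^+ k <= M.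

(** Bernoulli's inequality: (1 + k h) q^k <= 1 where 1 / q = 1 + h. *)
Lemma natr_geometric_le (R : realType) (q : R) (k : nat) : 0 < q < 1 ->
  k%:R * q ^+ k <= (q^-1 - 1)^-1.
Proof.
move=> /andP[q0 q1].
set h := q^-1 - 1.
have h0 : 0 < h by rewrite subr_gt0 invf_gt1.
have le1 : (1 + k%:R * h) * q ^+ k <= 1.
  elim: k => [|k ih]; first by rewrite mul0r addr0 mulr1.
  apply: le_trans ih; rewrite exprS mulrA.
  rewrite ler_wpM2r ?exprn_ge0 ?(ltW q0)// -ler_pdivlMr//.
  have -> : q^-1 = 1 + h by rewrite /h addrC subrK.
  have : 0 <= k%:R * h * h by rewrite !mulr_ge0// ltW.
  rewrite -natr1; lra.
rewrite -[leRHS]mul1r ler_pdivlMr// mulrAC (le_trans _ le1)//.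
by rewrite ler_wpM2r ?exprn_ge0 ?(ltW q0)// lerDr.
Qed.

(** The linear factor is absorbed by passing from the radius r to a radius K
    between r and 1, since k (r / K)^k is bounded. *)
Lemma disk_bounded_affine (R : realType) (mu : R) (c : nat -> R) :
  disk_bounded c -> disk_bounded (fun k => (mu + k%:R) * c k).
Proof.
move=> bc r /andP[r0 r1]; pose K := (1 + r) / 2.
have rK : r < K by rewrite /K; lra.
have K1 : K < 1 by rewrite /K; lra.
have K0 : 0 < K by exact: lt_trans rK.
have [M HM] := bc K (introT andP (conj K0 K1)).
pose q := r / K.
have q01 : 0 < q < 1 by rewrite /q divr_gt0// ltr_pdivrMr// mul1r.
exists ((`|mu| + (q^-1 - 1)^-1) * M) => k.
have -> : `|(mu + k%:R) * c k| * r ^+ k =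
    (`|mu + k%:R| * q ^+ k) * (`|c k| * K ^+ k).
  rewrite normrM mulrACA -exprMn /q divfK ?gt_eqF//.
apply: ler_pM => //.
- by rewrite mulr_ge0// exprn_ge0// ltW//; case/andP: q01.
- by rewrite mulr_ge0// exprn_ge0// ltW.
apply: (@le_trans _ _ ((`|mu| + k%:R) * q ^+ k)).
  rewrite ler_wpM2r ?exprn_ge0//; first by rewrite ltW//; case/andP: q01.
  by rewrite (le_trans (ler_normD _ _))// normr_nat.
rewrite mulrDl lerD// ?natr_geometric_le//.
case/andP: q01 => q0 q1.
by rewrite ler_piMr// exprn_ile1// ltW.
Qed.

Lemma disk_boundedZ (R : realType) (A : R) (c : nat -> R) :
  disk_bounded c -> disk_bounded (fun k => A * c k).
Proof.
move=> bc r r01; have [M HM] := bc r r01; exists (`|A| * M) => k.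
by rewrite normrM -mulrA ler_wpM2l.
Qed.

Lemma disk_bounded_diffs (R : realType) (c : nat -> R) :
  disk_bounded c -> disk_bounded (pseries_diffs c).
Proof.
move=> bc r r01; have [M HM] := disk_bounded_affine 0 bc r01.
exists (M / r) => k; case/andP: r01 => r0 r1.
have := HM k.+1; rewrite add0r /pseries_diffs => H.
by rewrite ler_pdivlMr// -mulrA -exprSr.
Qed.

Lemma disk_bounded_cvg_norm (R : realType) (c : nat -> R) (x : R) :
  disk_bounded c -> `|x| < 1 -> cvgn (series (fun k => `|c k * x ^+ k|)).
Proof.
move=> bc x1; pose r := (1 + `|x|) / 2.
have x0 : 0 <= `|x| by [].
have xr : `|x| < r by rewrite /r; lra.
have r1 : r < 1 by rewrite /r; lra.
have r0 : 0 < r by rewrite /r; lra.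
have [M HM] := bc r (introT andP (conj r0 r1)).
have q1 : `|(`|x| / r)| < 1.
  by rewrite ger0_norm ?ltr_pdivrMr ?mul1r// divr_ge0// ltW.
apply: (@series_le_cvg _ _ (geometric M (`|x| / r))).
- by [].
- move=> k; apply: geometric_ge0; last by rewrite divr_ge0// ltW.
  by apply: le_trans (HM 0%N); rewrite mulr_ge0.
- move=> k; rewrite /geometric/= normrM normrX.
  have -> : `|x| ^+ k = r ^+ k * (`|x| / r) ^+ k.
    by rewrite -exprMn mulrC divfK ?gt_eqF.
  by rewrite mulrA ler_wpM2r// exprn_ge0// divr_ge0// ltW.
- exact: is_cvg_geometric_series.
Qed.

Lemma disk_bounded_cvg (R : realType) (c : nat -> R) (x : R) :
  disk_bounded c -> `|x| < 1 -> cvgn (pseries c x).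
Proof. by move=> bc x1; apply: normed_cvg; exact: disk_bounded_cvg_norm. Qed.

Lemma lim_pseriesZ (R : realType) (A : R) (c : nat -> R) (x : R) :
  cvgn (pseries c x) ->
  limn (pseries (fun k => A * c k) x) = A * limn (pseries c x).
Proof.
move=> cc; apply/cvg_lim => //.
rewrite (_ : pseries _ _ = fun n => A * pseries c x n); first exact: cvgMr.
apply/funext => n; rewrite /pseries /series/= mulr_sumr.
by apply: eq_bigr => k _; rewrite mulrA.
Qed.

(** Termwise differentiation at x is legitimate once the series and its first
    two formal derivatives converge at some K with |x| < |K| < 1. *)
Lemma is_derive_pseries (R : realType) (c : nat -> R) (x : R) :
  disk_bounded c -> `|x| < 1 ->
  is_derive x 1 (fun t => limn (pseries c t)) (limn (pseries (pseries_diffs c) x)).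
Proof.
move=> bc x1; pose K := (1 + `|x|) / 2.
have x0 : 0 <= `|x| by [].
have K1 : `|K| < 1 by rewrite ger0_norm /K; lra.
apply: (@pseries_snd_diffs _ _ K).
- exact: disk_bounded_cvg.
- by apply: disk_bounded_cvg => //; exact: disk_bounded_diffs.
- by apply: disk_bounded_cvg => //; do 2 apply: disk_bounded_diffs.
- by rewrite [ltRHS]ger0_norm /K; lra.
Qed.

(** Multiplying the k-th coefficient by k is the Euler operator x d/dx. *)
Lemma pseries_affine (R : realType) (mu : R) (c : nat -> R) (x : R) :
  disk_bounded c -> `|x| < 1 ->
  limn (pseries (fun k => (mu + k%:R) * c k) x) =
  mu * limn (pseries c x) + x * limn (pseries (pseries_diffs c) x).
Proof.
move=> bc x1.
have cd : cvgn (pseries (pseries_diffs c) x).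
  by apply: disk_bounded_cvg => //; exact: disk_bounded_diffs.
have cc : cvgn (pseries c x) by exact: disk_bounded_cvg.
apply/cvg_lim => //.
rewrite (_ : pseries _ _ = (fun n => mu * pseries c x n +
    x * series (fun i => i%:R * c i * x ^+ i.-1) n)); last first.
  apply/funext => n; rewrite /pseries /series/= !mulr_sumr -big_split/=.
  apply: eq_bigr => -[|k] _ /=; first by rewrite !mul0r mulr0 !addr0 mulrA.
  by rewrite exprS; ring.
by apply: cvgD; apply: cvgMr => //; exact: pseries_diffs_equiv.
Qed.

Lemma mulr_powR_pred (R : realType) (x p : R) : 0 < x ->
  x * x `^ (p - 1) = x `^ p.
Proof.
move=> x0; rewrite -[X in X * _]powRr1 ?ltW// -powRD ?(gt_eqF x0) ?implybT//.
by rewrite addrC subrK.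
Qed.

(** Termwise, the derivative of x^(mu + k) is (mu + k) x^(mu + k - 1); the form
    of the function is preserved, so the lemma can be iterated. *)
Lemma is_derive_powR_pseries (R : realType) (mu : R) (c : nat -> R) (x : R) :
  disk_bounded c -> 0 < x < 1 ->
  is_derive x 1 (fun t => t `^ mu * limn (pseries c t))
    (x `^ (mu - 1) * limn (pseries (fun k => (mu + k%:R) * c k) x)).
Proof.
move=> bc /andP[x0 x1].
have nx1 : `|x| < 1 by rewrite gtr0_norm.
have D1 := is_derive1_powR mu x0.
have D2 := is_derive_pseries bc nx1.
apply: (@is_derive_eq _ _ _ _ _ _ _ _ (is_deriveM D1 D2)).
rewrite pseries_affine// -[X in X *: _ + _](mulr_powR_pred _ x0).
rewrite /GRing.scale/=; ring.
Qed.

(** The coefficient of x^k in (1 - x)^(- a). *)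
Definition binom_coef (R : realType) (a : R) (k : nat) : R :=
  pochhammer a k / k`!%:R.

Lemma binom_coefS (R : realType) (a : R) (k : nat) :
  k.+1%:R * binom_coef a k.+1 = (a + k%:R) * binom_coef a k.
Proof.
rewrite /binom_coef /pochhammer big_ord_recr/= factS natrM.
by field; rewrite nat1r !pnatr_eq0 -lt0n fact_gt0.
Qed.

(** If |a| <= N, the coefficients grow at most like the polynomial
    (k + 1) ... (k + N), by comparison of the ratios of successive terms. *)
Lemma disk_bounded_binom (R : realType) (a : R) : disk_bounded (binom_coef a).
Proof.
pose N := (Num.trunc `|a|).+1.
have aN : `|a| <= N%:R by have /andP[_ /ltW] := truncn_itv (normr_ge0 a).
(* The ratio of d at k + 1 and k is (k + 1 + N) / (k + 1); for the coefficients
   it is (k + a) / (k + 1). *)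
pose d k : R := \prod_(j < N) (j.+1%:R + k%:R).
have bd : disk_bounded d.
  rewrite /d; elim: (N) => [r /andP[r0 r1]|m ih].
    by exists 1 => k; rewrite big_ord0 normr1 mul1r exprn_ile1// ltW.
  have := disk_bounded_affine m.+1%:R ih; congr disk_bounded.
  by apply/funext => k; rewrite big_ord_recr/= mulrC.
have d0 k : 0 <= d k by apply: prodr_ge0 => j _; rewrite addr_ge0.
have le k : `|binom_coef a k| <= d k.
  elim: k => [|k ih].
    rewrite /binom_coef /pochhammer big_ord0 fact0 divr1 normr1 /d.
    elim: (N) => [|m ihm]; first by rewrite big_ord0.
    by rewrite big_ord_recr/= addr0 -[leLHS]mulr1 ler_pM// ler1n.
  have dS : k.+1%:R * d k.+1 = (k.+1%:R + N%:R) * d k.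
    rewrite /d; elim: (N) => [|m ihm]; first by rewrite !big_ord0 addr0.
    rewrite !big_ord_recr/= mulrA ihm -!natr1; ring.
  rewrite -(@ler_pM2l _ k.+1%:R) ?ltr0n// dS -[X in X * _]normr_nat -normrM binom_coefS.
  rewrite normrM ler_pM// (le_trans (ler_normD _ _))// normr_nat addrC lerD//.
  by rewrite ler_nat.
move=> r r01; have [M HM] := bd r r01; exists M => k.
apply: le_trans (HM k); rewrite ler_wpM2r ?exprn_ge0//; first by case/andP: r01 => /ltW.
by rewrite (ger0_norm (d0 k)).
Qed.

Lemma pseries_at0 (R : realType) (c : nat -> R) : limn (pseries c 0) = c 0%N.
Proof.
apply/cvg_lim => //; rewrite -cvg_shiftS.
rewrite (_ : (fun n => _) = (fun=> c 0%N)); first exact: cvg_cst.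
apply/funext => n; rewrite /pseries /series/= big_nat_recl//= expr0 mulr1.
by rewrite big1 ?addr0// => i _; rewrite expr0n mulr0.
Qed.

(** The recurrence of the coefficients says that the sum S satisfies
    (1 - x) S' = a S, so S (1 - x)^a is constant. *)
Lemma binomial_series (R : realType) (a x : R) : 0 <= x < 1 ->
  limn (pseries (binom_coef a) x) = (1 - x) `^ (- a).
Proof.
move=> /andP[x0 x1]; pose S t := limn (pseries (binom_coef a) t).
pose h (t : R) := S t * (1 - t) `^ a.
have bc := disk_bounded_binom a.
have dh (t : R) : `|t| < 1 -> is_derive t 1 h 0.
  move=> t1; have t1' : 0 < 1 - t by rewrite subr_gt0 (le_lt_trans (ler_norm _) t1).
  have DS := is_derive_pseries bc t1.
  have Dp := is_derive1_powR a t1'.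
  have D1 : is_derive t 1 (fun t : R => 1 - t) (-1).
    have := is_deriveB (is_derive_cst (1 : R) t 1) (is_derive_id t 1).
    by rewrite sub0r.
  have D2 := @is_derive1_comp _ (fun y : R => y `^ a) (fun t : R => 1 - t) t _ _ Dp D1.
  apply: (is_derive_eq (is_deriveM DS D2)).
  (* The coefficients of S' are (a + k) c_k, which is a S + t S' term by term. *)
  have ode : limn (pseries (pseries_diffs (binom_coef a)) t) =
      a * S t + t * limn (pseries (pseries_diffs (binom_coef a)) t).
    rewrite -pseries_affine//; congr (limn (pseries _ _)).
    by apply/funext => k; rewrite /pseries_diffs binom_coefS.
  rewrite /GRing.scale/= -/(S t) -(mulr_powR_pred a t1') -/(S t).
  set P := _ `^ (a - 1); set S' := limn _ in ode *.
  have -> : S t * (a * P * -1) + (1 - t) * P * S' = P * (S' - (a * S t + t * S')).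
    by ring.
  by rewrite -ode subrr mulr0.
have cst : h x = h 0.
  have [||_ _] := @MVT_segment _ h (fun=> 0) 0 x x0.
  - by move=> t; rewrite in_itv/= => /andP[t0 tx]; apply: dh;
      rewrite gtr0_norm// (lt_trans tx).
  - apply: continuous_in_subspaceT => t; rewrite inE/= in_itv/= => /andP[t0 tx].
    apply: differentiable_continuous; apply/derivable1_diffP.
    by have [] := dh t _; rewrite ?ger0_norm ?(le_lt_trans tx).
  - by rewrite mul0r => /eqP; rewrite subr_eq0 => /eqP.
have x1' : 0 < 1 - x by rewrite subr_gt0.
have h0 : h 0 = 1.
  rewrite /h /S pseries_at0 subr0 powR1 mulr1 /binom_coef /pochhammer big_ord0.
  by rewrite fact0 divr1.
have nz : (1 - x) `^ a != 0 by rewrite gt_eqF// powR_gt0.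
by apply: (mulIf nz); rewrite powRN mulVf//; rewrite -/(h x) cst.
Qed.

(** * Iterated derivatives of (1 - t^2)^nu *)

(** The coefficient of u^(nu - m + k) in the m-th derivative of u^nu (1 - u)^nu. *)
Definition derived_coef (R : realType) (nu : R) (m k : nat) : R :=
  (\prod_(j < m) (nu - j%:R + k%:R)) * binom_coef (- nu) k.

Lemma derived_coefS (R : realType) (nu : R) (m k : nat) :
  derived_coef nu m.+1 k = (nu - m%:R + k%:R) * derived_coef nu m k.
Proof. by rewrite /derived_coef big_ord_recr/= mulrAC mulrC. Qed.

Lemma disk_bounded_derived (R : realType) (nu : R) (m : nat) :
  disk_bounded (derived_coef nu m).
Proof.
elim: m => [|m ih].
  have := disk_bounded_binom (- nu); congr disk_bounded.
  by apply/funext => k; rewrite /derived_coef big_ord0 mul1r.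
have := disk_bounded_affine (nu - m%:R) ih; congr disk_bounded.
by apply/funext => k; rewrite derived_coefS.
Qed.

(** The case m = 0 is the binomial series in u = (t + 1) / 2; each further
    derivative in t brings the factor du/dt = 1 / 2. *)
Lemma derived_powR_expansion (R : realType) (nu : R) (m : nat) (t : R) :
  -1 < t < 1 ->
  derive1n m (fun s : R => (1 - s ^+ 2) `^ nu) t =
  4 `^ nu / 2 ^+ m * (((t + 1) / 2) `^ (nu - m%:R) *
    limn (pseries (derived_coef nu m) ((t + 1) / 2))).
Proof.
elim: m t => [|m ih] t /andP[t0 t1].
  rewrite derive1n0 expr0 divr1 subr0.
  have -> : derived_coef nu 0 = binom_coef (- nu).
    by apply/funext => k; rewrite /derived_coef big_ord0 mul1r.
  rewrite binomial_series; last by apply/andP; split; lra.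
  rewrite opprK -powRM; [|lra|lra]; rewrite -powRM; [|lra|].
    by congr (_ `^ _); field.
  by rewrite mulr_ge0//; lra.
rewrite derive1nS derive1E.
pose g (s : R) := s `^ (nu - m%:R) * limn (pseries (derived_coef nu m) s).
pose u (s : R) := (s + 1) / 2.
have Dg : is_derive (u t) 1 g ((u t) `^ (nu - m.+1%:R) *
    limn (pseries (derived_coef nu m.+1) (u t))).
  have := @is_derive_powR_pseries _ (nu - m%:R) _ (u t) (@disk_bounded_derived R nu m).
  have -> : (fun k : nat => (nu - m%:R + k%:R) * derived_coef nu m k) =
      derived_coef nu m.+1 by apply/funext => k; rewrite derived_coefS.
  rewrite -addrA -opprD natr1; apply.
  by rewrite /u; apply/andP; split; lra.
have Du : is_derive t 1 u 2^-1.
  have := is_deriveZ 2^-1 (is_deriveD (is_derive_id t 1) (is_derive_cst (1 : R) t 1)).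
  rewrite addr0 [2^-1 *: 1]mulr1; congr is_derive.
  by apply/funext => s; rewrite /u mulrC.
have D := is_deriveZ (4 `^ nu / 2 ^+ m) (@is_derive1_comp _ g u t _ _ Dg Du).
have [_ ->] : is_derive t 1 (derive1n m (fun s : R => (1 - s ^+ 2) `^ nu))
    ((4 `^ nu / 2 ^+ m) *: ((u t) `^ (nu - m.+1%:R) *
    limn (pseries (derived_coef nu m.+1) (u t)) * 2^-1)).
  apply: near_eq_is_derive D; near=> s; rewrite ih//.
  near: s; have : t \in `]-1, 1[ by rewrite in_itv/= t0 t1.
  by move=> /near_in_itvoo; apply: filterS => s; rewrite in_itv.
rewrite /GRing.scale/= exprS invfM; rewrite -/(u t); ring.
Unshelve. all: by end_near. Qed.

(** * Fractional integral of a power series *)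

(** With u = (t - a) / L, the k-th term of the integrand is a product of two
    truncated powers, whose integral is a Beta integral. On ]a, b[ the variable
    u stays below Z = (b - a) / L < 1, so the partial sums are dominated by the
    integrable k = 0 term times sum_k |c_k| Z^k. *)
Lemma cvg_fractional_integral_pseries (R : realType) (p q a b L : R)
  (c : nat -> R) :
  0 < p -> 0 < q -> a < b -> b - a < L -> disk_bounded c ->
  series (fun k => c k * (L^-1 `^ (p + k%:R - 1) *
    ((b - a) `^ (p + k%:R + q - 1) *
     (Gamma (p + k%:R) * Gamma q / Gamma (p + k%:R + q))))) @ \oo -->
  \int[lebesgue_measure]_(t in `]a, b[)
    (((t - a) / L) `^ (p - 1) * limn (pseries c ((t - a) / L)) *
     (b - t) `^ (q - 1)).
Proof.
move=> p0 q0 ab bL bc.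
have ba0 : 0 < b - a by rewrite subr_gt0.
have L0 : 0 < L by exact: lt_trans bL.
have Li0 : 0 < L^-1 by rewrite invr_gt0.
set w := fun k : nat => _.
pose phi k (t : R) := truncpow (p + k%:R) (L^-1 * (t - a)) * truncpow q (b - t).
have pk0 k : 0 < p + k%:R by rewrite ltr_wpDr.
have phi0 k t : 0 <= phi k t by rewrite mulr_ge0// truncpow_ge0.
have mphi k : measurable_fun setT (phi k).
  apply: measurable_funM; apply: measurable_truncpow_comp.
    by apply: measurable_funM => //; exact: measurable_funB.
  exact: measurable_funB.
have Iphi k : (\int[@lebesgue_measure R]_t (phi k t)%:E =
    (L^-1 `^ (p + k%:R - 1) * ((b - a) `^ (p + k%:R + q - 1) *
     (Gamma (p + k%:R) * Gamma q / Gamma (p + k%:R + q))))%:E)%E.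
  rewrite EFinM -integral_truncpow_mul_Gamma// -ge0_integralZl//=.
  - by apply: eq_integral => t _; rewrite /phi truncpowM// -mulrA EFinM.
  - apply/measurable_EFinP; apply: measurable_funM; apply: measurable_truncpow_comp;
      exact: measurable_funB.
  - by move=> t _; rewrite lee_fin mulr_ge0// truncpow_ge0.
  - by rewrite lee_fin powR_ge0.
have iphi k : (@lebesgue_measure R).-integrable setT (EFin \o phi k).
  apply/integrableP; split; first by apply/measurable_EFinP; exact: mphi.
  under eq_integral => t _ do rewrite /= ger0_norm//.
  by rewrite Iphi ltry.
pose Z := (b - a) / L.
have Z0 : 0 <= Z by rewrite divr_ge0// ltW.
have Z1 : `|Z| < 1 by rewrite ger0_norm// /Z ltr_pdivrMr// mul1r.
have cZ := disk_bounded_cvg_norm bc Z1.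
pose M := limn (series (fun k => `|c k * Z ^+ k|)).
pose F (N : nat) (t : R) := (\sum_(0 <= k < N) (c k * phi k t)%:E)%E.
pose f (t : R) := (phi 0%N t * limn (pseries c (L^-1 * (t - a))))%:E.
have phiE k t : phi k t = phi 0%N t * (L^-1 * (t - a)) ^+ k.
  by rewrite /phi truncpow_addn addr0 mulrAC.
have phi_out t : ~~ (a < t < b) -> phi 0%N t = 0.
  rewrite /phi /truncpow pmulr_rgt0// !subr_gt0.
  by case: (ltP a t) => at_; case: (ltP t b) => tb //=; rewrite ?mulr0 ?mul0r.
have u01 t : a < t < b -> 0 <= L^-1 * (t - a) <= Z.
  move=> /andP[at_ tb]; rewrite mulr_ge0 ?subr_ge0 ?(ltW Li0) ?(ltW at_)//=.
  by rewrite /Z mulrC ler_pM2r// lerB// ltW.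
have FE N t : F N t = (phi 0%N t * pseries c (L^-1 * (t - a)) N)%:E.
  rewrite /F sumEFin /pseries /series/= mulr_sumr; congr EFin.
  by apply: eq_bigr => k _; rewrite phiE mulrCA.
have mF N : measurable_fun setT (F N).
  by apply: emeasurable_sum => k; apply/measurable_EFinP/measurable_funM.
have Ff t : F ^~ t @ \oo --> f t.
  rewrite (_ : F ^~ t = fun N => (phi 0%N t * pseries c (L^-1 * (t - a)) N)%:E);
    last by apply/funext => N; exact: FE.
  apply: cvg_EFin; first exact: nearW.
  have [/u01/andP[u0 uZ]|/phi_out->] := boolP (a < t < b); last first.
    rewrite mul0r; under eq_fun do rewrite mul0r; exact: cvg_cst.
  apply: cvgMr; apply: disk_bounded_cvg => //.
  by rewrite ger0_norm// (le_lt_trans uZ)// -[X in X < _](ger0_norm Z0).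
have mf : measurable_fun setT f.
  exact: (emeasurable_fun_cvg _ _ mF (fun t _ => Ff t)).
have dom t N : (`|F N t| <= (phi 0%N t * M)%:E)%E.
  rewrite FE [X in (X <= _)%E]/= lee_fin normrM ger0_norm//.
  have [/u01/andP[u0 uZ]|/phi_out->] := boolP (a < t < b); last by rewrite !mul0r.
  rewrite ler_wpM2l//.
  apply: (@le_trans _ _ (series (fun k => `|c k * Z ^+ k|) N)).
    rewrite (le_trans (ler_norm_sum _ _ _))// ler_sum// => k _.
    rewrite !normrM ler_wpM2l// !normrX lerXn2r ?nnegrE// ger0_norm// ger0_norm//.
  apply: nondecreasing_cvgn_le => //.
  by apply: nondecreasing_series => k _ _.
have iM : (@lebesgue_measure R).-integrable setT (fun t => (phi 0%N t * M)%:E).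
  rewrite (_ : (fun t => _) = (fun t => (M%:E * (phi 0%N t)%:E)%E)).
    by apply: integrableZl => //; exact: iphi.
  by apply/funext => t; rewrite -EFinM mulrC.
have [| |intf _] := @dominated_convergence _ _ R (@lebesgue_measure R) setT measurableT
  F f (fun t => (phi 0%N t * M)%:E) mF mf _ iM.
- by apply: aeW => t _; exact: Ff.
- by apply: aeW => t N _; exact: dom.
rewrite (_ : (fun N => _) = EFin \o series w); last first.
  apply/funext => N; rewrite /F integral_sum//=; last first.
    by move=> k; exact: (integrableZl measurableT (c k) (iphi k)).
  rewrite /series/= -sumEFin; apply: eq_bigr => k _.
  rewrite /w EFinM -Iphi -(integralZl measurableT (iphi k)).
  exact: eq_integral.
have -> : \int[lebesgue_measure]_(t in `]a, b[)
    (((t - a) / L) `^ (p - 1) * limn (pseries c ((t - a) / L)) *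
     (b - t) `^ (q - 1)) = fine (\int[@lebesgue_measure R]_x f x).
  rewrite Rintegral_mkcond; congr fine; apply: eq_integral => t _.
  rewrite /f patchE mem_setE in_itv/=; case: ifPn => [/andP[at_ tb]|/phi_out->].
    rewrite /phi /truncpow pmulr_rgt0// !subr_gt0 at_ tb addr0 (mulrC L^-1).
    by rewrite mulrAC.
  by rewrite mul0r.
rewrite -{1}(@fineK _ (\int[@lebesgue_measure R]_x f x)); last exact: integrable_fin_num.
by move=> /fine_cvgP[].
Qed.

(** * The Caputo derivative of (1 - t^2)^nu *)

(** The exponents of the fractional integral are p - 1 = nu - n and
    q - 1 = n - nu - 1. Because p + q = 1, the Beta integral of the k-th term
    has denominator Gamma(k + 1) = k! and scales like (x + 1)^k. *)
Lemma caputo_one_minus_sq (R : realType) (n : nat) (nu x : R) :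
  n%:R - 1 < nu < n%:R -> -1 < x < 1 ->
  caputo n nu (-1) (fun t => (1 - t ^+ 2) `^ nu) x =
  2 `^ nu * Gamma (nu + 1) * hyp2F1 (- nu) (nu + 1) 1 ((x + 1) / 2).
Proof.
move=> /andP[nu0 nu1] /andP[x0 x1].
pose p := nu - n%:R + 1; pose q := n%:R - nu.
have p0 : 0 < p by rewrite /p; lra.
have q0 : 0 < q by rewrite /q; lra.
have nu1_gt0 : 0 < nu + 1.
  have : 0 <= n%:R :> R by []. rewrite /p in p0; lra.
(* The constant is put into the coefficients rather than pulled out of the
   integral, which would need integrability. *)
pose A : R := 4 `^ nu / 2 ^+ n.
pose c k := A * derived_coef nu n k.
have bd := @disk_bounded_derived R nu n.
have bc : disk_bounded c by exact: disk_boundedZ.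
have integrandE : \int[lebesgue_measure]_(tau in `]-1, x[)
     (derive1n n (fun t => (1 - t ^+ 2) `^ nu) tau / (x - tau) `^ (nu + 1 - n%:R)) =
   \int[lebesgue_measure]_(t in `]-1, x[)
    (((t - -1) / 2) `^ (p - 1) * limn (pseries c ((t - -1) / 2)) *
     (x - t) `^ (q - 1)).
  apply: eq_Rintegral => t; rewrite inE/= in_itv/= => /andP[t0 tx].
  have t1 : t < 1 by exact: lt_trans x1.
  rewrite derived_powR_expansion ?t0// opprK -powRN lim_pseriesZ; last first.
    by apply: disk_bounded_cvg => //; rewrite ger0_norm; lra.
  rewrite /p addrK (_ : - (nu + 1 - n%:R) = q - 1); last by rewrite /q; ring.
  by rewrite -/A; ring.
have gamma_nz s : 0 < s -> Gamma s != 0 :> R by move=> s0; rewrite gt_eqF// Gamma_gt0.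
rewrite /caputo integrandE -/q.
have x2 : x - -1 < 2 by lra.
have := cvg_fractional_integral_pseries p0 q0 x0 x2 bc.
set I := \int[_]_(_ in _) _; move=> cvgI.
suff cvgH : series (fun k : nat =>
    pochhammer (- nu) k * pochhammer (nu + 1) k / pochhammer 1 k *
    (((x + 1) / 2) ^+ k / k`!%:R)) @ \oo -->
    (2 `^ nu * Gamma (nu + 1))^-1 * ((Gamma q)^-1 * I).
  rewrite /hyp2F1 (cvg_lim _ cvgH)// mulVKf//.
  by rewrite mulf_neq0 ?gamma_nz// gt_eqF// powR_gt0.
set w := fun k : nat => _ in cvgI.
rewrite (_ : series _ = (fun N => (2 `^ nu * Gamma (nu + 1))^-1 *
   ((Gamma q)^-1 * series w N))); first by apply: cvgMr; exact: cvgMr.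
apply/funext => N; rewrite /series/= !mulr_sumr; apply: eq_bigr => k _.
rewrite /w /c /derived_coef /binom_coef opprK.
have -> : p + k%:R + q - 1 = k%:R by rewrite /p /q; ring.
have -> : p + k%:R + q = k.+1%:R by rewrite -natr1 /p /q; ring.
rewrite Gamma_nat powR_mulrn; last lra.
rewrite pochhammer1.
have G1 := Gamma_pochhammer k nu1_gt0.
have -> : \prod_(j < n) (nu - j%:R + k%:R) = \prod_(j < n) (nu + k%:R - j%:R).
  by apply: eq_bigr => j _; ring.
(* The derivatives' falling product is what separates Gamma(p + k) from
   Gamma(nu + 1 + k). *)
have G2 : Gamma (nu + 1 + k%:R) =
    (\prod_(j < n) (nu + k%:R - j%:R)) * Gamma (p + k%:R).
  have -> : nu + 1 + k%:R = nu + k%:R + 1 by ring.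
  rewrite (@Gamma_falling _ _ n); last first.
    have : 0 <= k%:R :> R by []. rewrite /p in p0; lra.
  by congr (_ * Gamma _); rewrite /p; ring.
have pw : A * 2^-1 `^ (p + k%:R - 1) = 2 `^ nu / 2 ^+ k.
  have nz2 : (2 : R) != 0 by [].
  have -> : (2^-1 : R) = 2 `^ (-1) by rewrite powR_inv1.
  have -> : p + k%:R - 1 = nu + k%:R - n%:R by rewrite /p; ring.
  rewrite -powRrM mulN1r powRN powRB ?nz2 ?implybT// powRD ?nz2 ?implybT//.
  rewrite !powR_mulrn// /A (_ : 4 = 2 * 2 :> R); last by ring.
  rewrite powRM//; field.
  by rewrite !expf_neq0// gt_eqF// powR_gt0.
have nzk : (k`!%:R : R) != 0 by rewrite pnatr_eq0 -lt0n fact_gt0.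
have nzq := gamma_nz _ q0.
have nznu := gamma_nz _ nu1_gt0.
have nz2nu : 2 `^ nu != 0 :> R by rewrite gt_eqF// powR_gt0.
set P := \prod_(j < n) _ in G2 *.
have G3 : P * Gamma (p + k%:R) = pochhammer (nu + 1) k * Gamma (nu + 1) by rewrite -G2 G1.
rewrite expr_div_n.
transitivity ((2 `^ nu * Gamma (nu + 1))^-1 * ((Gamma q)^-1 * (A * 2^-1 `^ (p + k%:R - 1) *
  (P * Gamma (p + k%:R)) * (pochhammer (- nu) k / k`!%:R) * (x + 1) ^+ k *
  (Gamma q / k`!%:R)))).
  rewrite pw G3; field.
  by rewrite nzk nz2nu nzq nznu expf_neq0.
ring.
Qed.

Unset Implicit Arguments.
Local Open Scope complex_scope.

Theorem theorem3p14 (R : realType) (n : nat) (nu x : R)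
  (hn : (0 < n)%N) (hnu : n%:R - 1 < nu < n%:R) (hx : -1 < x < 1) :
  CLegendre n nu x
  = neg1pow nu * (hyp2F1 (- nu) (nu + 1) 1 ((x + 1) / 2))%:C.
Proof.
rewrite /CLegendre caputo_one_minus_sq// [X in _ * X = _]rmorphM/= mulrA divfK//.
have nu1 : 0 < nu + 1.
  by have := ler1n R n; rewrite hn; case/andP: hnu => + _; lra.
by rewrite fmorph_eq0 gt_eqF// mulr_gt0 ?powR_gt0// Gamma_gt0.
Qed.
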